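(* Let $\mathscr{M}=\{m_n\}_{n\in\mathbb{N}_0}$ be a weight sequence, $N\ge1$, and let $u\in\mathscr{D}'_{\mathscr{M}}(\mathbb{T}^N)$. For every $\varepsilon>0$ there exists $C_\varepsilon>0$ such that $$|\widehat{u}(\xi)|\le C_\varepsilon\cdot\sup_{n\in\mathbb{N}_0}\left(\frac{\varepsilon^n(1+|\xi|)^n}{m_n\cdot n!}\right),\qquad\forall\xi\in\mathbb{Z}^N.$$
   Context: $\mathbb{N}=\{1,2,\dots\}$, $\mathbb{N}_0=\mathbb{N}\cup\{0\}$, $\mathbb{T}^N=\mathbb{R}^N/2\pi\mathbb{Z}^N$, and $|\xi|$ is the Euclidean norm of $\xi\in\mathbb{Z}^N$. A weight sequence is a sequence $\mathscr{M}=\{m_n\}_{n\in\mathbb{N}_0}$ of positive reals with: $m_0=m_1=1$; $m_n^2\le m_{n-1}m_{n+1}$ for all $n\in\mathbb{N}$; and there is $H>1$ with $m_{j+k}\le H^{j+k}m_jm_k$ for all $j,k\in\mathbb{N}_0$. $\mathcal{E}_{\mathscr{M}}(\mathbb{T}^N)$ is the space of $f\in C^\infty(\mathbb{T}^N)$ (complex-valued) for which there are $C,h>0$ with $|D^\alpha f(x)|\le C h^{|\alpha|}m_{|\alpha|}|\alpha|!$ for all $x\in\mathbb{T}^N$, $\alpha\in\mathbb{N}_0^N$, where $D=-i\partial$. For $h>0$, $\mathcal{E}_{\mathscr{M},h}(\mathbb{T}^N)$ is the Banach space of those $f$ with $\|f\|_{\mathscr{M},h}:=\sup_{x,\alpha}\frac{|D^\alpha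 f(x)|}{h^{|\alpha|}m_{|\alpha|}|\alpha|!}<\infty$. $\mathcal{E}_{\mathscr{M}}(\mathbb{T}^N)$ carries the locally convex inductive limit topology of the spaces $\mathcal{E}_{\mathscr{M},h_n}(\mathbb{T}^N)$ for any strictly increasing positive sequence $h_n\to+\infty$ (the topology does not depend on the choice). $\mathscr{D}'_{\mathscr{M}}(\mathbb{T}^N)$ is the topological dual of $\mathcal{E}_{\mathscr{M}}(\mathbb{T}^N)$ (continuous linear functionals $u:\mathcal{E}_{\mathscr{M}}(\mathbb{T}^N)\to\mathbb{C}$), and $\widehat u(\xi)=\frac{1}{(2\pi)^N}\langle u,e^{-ix\xi}\rangle$ for $\xi\in\mathbb{Z}^N$. *)

(* Defs.v *)
From HB Require Import structures.
From mathcomp Require Import all_boot all_order all_algebra.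
From mathcomp Require Import all_classical all_reals all_analysis.
From mathcomp Require Import complex.
From mathcomp Require Import ring lra.
Set Implicit Arguments.
Unset Strict Implicit.
Unset Printing Implicit Defensive.
Import Order.TTheory GRing.Theory Num.Theory.
Import numFieldNormedType.Exports.
Import Normc.
Local Open Scope classical_set_scope.
Local Open Scope complex_scope.
Local Open Scope ring_scope.

Record weight_sequence (R : realType) := WeightSequence {
  weight :> nat -> R ;
  weight_gt0 : forall n, 0 < weight n ;
  weight0 : weight 0%N = 1 ;
  weight1 : weight 1%N = 1 ;
  weight_logconvex : forall n,
    weight n.+1 ^+ 2 <= weight n * weight n.+2 ;
  weight_moderate : exists2 H : R, 1 < H &
    forall j k, weight (j + k)%N <= H ^+ (j + k) * weight j * weight k }.

Section Derivatives.
Variables (R : realType) (N : nat).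
Implicit Types (f g : 'rV[R]_N -> R) (F G : 'rV[R]_N -> R[i]).
Implicit Types (s : seq 'I_N) (a : {ffun 'I_N -> nat}).

Definition pderivs s f : 'rV[R]_N -> R :=
  foldr (fun i g => 'D_(delta_mx 0 i) g) f s.

Definition smoothR f := forall s,
  continuous (pderivs s f) /\
  forall i x, derivable (pderivs s f) x (delta_mx 0 i).

Definition smooth F :=
  smoothR (fun x => complex.Re (F x)) /\ smoothR (fun x => complex.Im (F x)).

(* Functions on the torus are 2pi-periodic functions on R^N. *)
Definition periodic2pi F := forall x i, F (x + (pi *+ 2) *: delta_mx 0 i) = F x.

Definition mlen a : nat := \sum_i a i.

(* The order of differentiation for the multi-index a: a i copies of each i. *)
Definition mword a : seq 'I_N := flatten [seq nseq (a i) i | i <- enum 'I_N].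

(* D^a with D = -i d/dx, acting on real and imaginary parts. *)
Definition Dmulti a F : 'rV[R]_N -> R[i] := fun x =>
  (- 'i%C) ^+ mlen a *
  (pderivs (mword a) (fun y => complex.Re (F y)) x +i*
   pderivs (mword a) (fun y => complex.Im (F y)) x).

Lemma pderivs_lin (c d : R) f g s : smoothR f -> smoothR g ->
  pderivs s (fun x => c * f x + d * g x) =
  (fun x => c * pderivs s f x + d * pderivs s g x).
Proof.
move=> sf sg; elim: s => [//|i s IH] /=; rewrite -!/(pderivs s _) IH.
have [_ df] := sf s; have [_ dg] := sg s.
apply/funext => x.
rewrite -[X in derive X _ _]/(c *: pderivs s f + d *: pderivs s g).
rewrite deriveD; [|exact/derivableZ|exact/derivableZ].
by rewrite !deriveZ.
Qed.

Lemma smoothR_lin (c d : R) f g : smoothR f -> smoothR g ->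
  smoothR (fun x => c * f x + d * g x).
Proof.
move=> sf sg s; rewrite pderivs_lin//.
have [cf df] := sf s; have [cg dg] := sg s; split=> [x|i x].
  by apply: (@continuousD _ R^o _ (fun y => c * pderivs s f y)
    (fun y => d * pderivs s g y));
    [apply: (@continuousM _ _ (cst c))|apply: (@continuousM _ _ (cst d))];
    (exact: cst_continuous || exact: cf || exact: cg).
rewrite -[X in derivable X]/(c *: pderivs s f + d *: pderivs s g).
by apply: derivableD; apply: derivableZ.
Qed.

Lemma ReIm_lin (c : R[i]) F G :
  (fun x => complex.Re (c * F x + G x)) =
    (fun x => 1 * (complex.Re c * complex.Re (F x) +
                   - complex.Im c * complex.Im (F x)) + 1 * complex.Re (G x)) /\
  (fun x => complex.Im (c * F x + G x)) =
    (fun x => 1 * (complex.Re c * complex.Im (F x) +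
                   complex.Im c * complex.Re (F x)) + 1 * complex.Im (G x)).
Proof.
split; apply/funext => x; case: c (F x) (G x) => [c1 c2] [f1 f2] [g1 g2] /=;
  ring.
Qed.

Lemma smooth_lin (c : R[i]) F G : smooth F -> smooth G ->
  smooth (fun x => c * F x + G x).
Proof.
move=> [rF iF] [rG iG]; rewrite /smooth; have [-> ->] := ReIm_lin c F G.
by split; do 2?apply: smoothR_lin.
Qed.

Lemma Dmulti_lin (c : R[i]) F G a x : smooth F -> smooth G ->
  Dmulti a (fun x => c * F x + G x) x = c * Dmulti a F x + Dmulti a G x.
Proof.
move=> [rF iF] [rG iG]; rewrite /Dmulti; have [-> ->] := ReIm_lin c F G.
rewrite !pderivs_lin//; try exact: smoothR_lin.
rewrite [c * (_ * _)]mulrCA -[RHS]mulrDr; congr (_ * _); case: c => c1 c2 /=.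
by apply/eqP; rewrite eq_complex /=; apply/andP; split; apply/eqP; ring.
Qed.

Lemma smoothR0 : smoothR (fun _ : 'rV[R]_N => 0 : R).
Proof.
have p0 s : pderivs s (fun _ : 'rV[R]_N => 0 : R) = cst 0.
  by elim: s => [//|i s IH] /=; rewrite -/(pderivs s _) IH;
    apply/funext => x; rewrite derive_cst.
move=> s; rewrite p0; split=> [|i x]; [exact: cst_continuous|exact: derivable_cst].
Qed.

Lemma Dmulti0 a (x : 'rV[R]_N) : Dmulti a (0 : 'rV[R]_N -> R[i]) x = 0.
Proof.
have sm0 : smooth (0 : 'rV[R]_N -> R[i]) by split; exact: smoothR0.
have := @Dmulti_lin (-1) 0 0 a x sm0 sm0; rewrite mulN1r addNr => <-.
by congr (Dmulti _ _ _); apply/funext => y; rewrite mulr0 add0r.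
Qed.

End Derivatives.

Lemma normc_le_add (R : rcfType) (x y : R[i]) :
  normc (x + y) <= normc x + normc y.
Proof. exact: le_normcD. Qed.

Lemma normc_nonneg (R : rcfType) (x : R[i]) : 0 <= normc x.
Proof. by case: x => a b; exact: sqrtr_ge0. Qed.

Lemma normc2 (R : rcfType) : normc (2 : R[i]) = 2.
Proof.
by rewrite -[2 in LHS]/((1 + 1) +i* (0 + 0)) /= addr0 expr0n addr0 sqrtr_sqr
  ger0_norm.
Qed.

Section UltradifferentiableFunctions.
Variables (R : realType) (M : weight_sequence R) (N : nat).

Definition ultradiff_bound (F : 'rV[R]_N -> R[i]) (C h : R) := forall x a,
  normc (Dmulti a F x) <= C * h ^+ mlen a * M (mlen a) * (mlen a)`!%:R.

Definition ultradiff_pred : {pred 'rV[R]_N -> R[i]} := fun F =>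
  `[< [/\ smooth F, periodic2pi F &
      exists C h : R, [/\ 0 < C, 0 < h & ultradiff_bound F C h]] >].

Record ultradiff := Ultradiff {
  ultradiff_fun :> 'rV[R]_N -> R[i] ;
  ultradiff_funP : ultradiff_fun \in ultradiff_pred }.

HB.instance Definition _ := [isSub for ultradiff_fun].
HB.instance Definition _ := gen_eqMixin ultradiff.
HB.instance Definition _ := gen_choiceMixin ultradiff.

Lemma ultradiff_lin (c : R[i]) F G :
  F \in ultradiff_pred -> G \in ultradiff_pred ->
  c *: F + G \in ultradiff_pred.
Proof.
move=> /asboolP[sF pF [C [h [C0 h0 bF]]]] /asboolP[sG pG [D [k [D0 k0 bG]]]].
apply/asboolP.
rewrite -[X in smooth X]/(fun x => c * F x + G x).
split; first exact: smooth_lin.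
  by move=> x i; congr (_ * _ + _); [exact: pF|exact: pG].
have hk0 : 0 < Num.max h k by rewrite lt_max h0.
exists (normc c * C + D), (Num.max h k); split=> //.
  by rewrite ltr_wpDl// mulr_ge0 ?normc_nonneg// ltW.
move=> x a; rewrite -[X in Dmulti a X]/(fun x => c * F x + G x) Dmulti_lin//.
apply: (le_trans (normc_le_add _ _)); rewrite normcM.
have W0 : 0 <= M (mlen a) * (mlen a)`!%:R by rewrite mulr_ge0// ltW// weight_gt0.
rewrite !mulrDl lerD//.
  rewrite -!mulrA ler_wpM2l ?normc_nonneg//.
  apply: (le_trans (bF x a)); rewrite -!mulrA ler_wpM2l ?(ltW C0)//.
  by rewrite ler_wpM2r// lerXn2r ?nnegrE ?(ltW h0) ?(ltW hk0)// le_max lexx.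
apply: (le_trans (bG x a)); rewrite -!mulrA ler_wpM2l ?(ltW D0)//.
by rewrite ler_wpM2r// lerXn2r ?nnegrE ?(ltW k0) ?(ltW hk0)// le_max lexx orbT.
Qed.

Lemma ultradiff_submod : GRing.submod_closed ultradiff_pred.
Proof.
split=> [|c F G]; last exact: ultradiff_lin.
apply/asboolP; have sm0 : smooth (0 : 'rV[R]_N -> R[i]).
  by split; exact: smoothR0.
split=> //; exists 1, 1; split=> // x a.
by rewrite Dmulti0 normc0 expr1n !mul1r mulr_ge0// ltW// weight_gt0.
Qed.

HB.instance Definition _ :=
  GRing.isSubmodClosed.Build _ _ ultradiff_pred ultradiff_submod.
HB.instance Definition _ := [SubChoice_isSubLmodule of ultradiff by <:].

Definition ultradiff_norm (h : R) (F : 'rV[R]_N -> R[i]) : \bar R :=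
  ereal_sup [set (normc (Dmulti p.2 F p.1) /
    (h ^+ mlen p.2 * M (mlen p.2) * (mlen p.2)`!%:R))%:E
    | p in [set: 'rV[R]_N * {ffun 'I_N -> nat}]].

(* The Banach space attached to h, as a subset; its norm is ultradiff_norm h. *)
Definition ultradiff_step (h : R) : set ultradiff :=
  [set F | ultradiff_norm h F < +oo]%E.

End UltradifferentiableFunctions.

(* The same space, to carry the inductive limit topology along the sequence h. *)
Definition ultradiff_lim (R : realType) (M : weight_sequence R) (N : nat)
  (h : nat -> R) : Type := ultradiff M N.

Section InductiveLimit.
Variables (R : realType) (M : weight_sequence R) (N : nat) (h : nat -> R).
Local Notation E := (ultradiff_lim M N h).

HB.instance Definition _ := GRing.Lmodule.copy E (ultradiff M N).

Definition absolutely_convex (W : set E) := forall (c d : R[i]) (F G : E),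
  normc c + normc d <= 1 -> W F -> W G -> W (c *: F + d *: G).

(* The locally convex inductive limit topology is the finest locally convex
   topology for which the inclusions of the steps are continuous: a basis of
   neighbourhoods of 0 is given by the absolutely convex sets whose trace on
   every step contains a ball around 0. *)
Definition lim_base (W : set E) := absolutely_convex W /\
  forall n, exists2 r : R, 0 < r &
    forall F : E, ultradiff_step (h n) F ->
      (ultradiff_norm M (h n) F < r%:E)%E -> W F.

Definition lim_nbhs (F : E) (A : set E) :=
  exists2 W, lim_base W & forall G, W G -> A (F + G).

HB.instance Definition _ := hasNbhs.Build E lim_nbhs.

Lemma ultradiff_norm0 k : ultradiff_norm M k (0 : E) = 0%E.
Proof.
rewrite /ultradiff_norm.
have -> : [set (normc (Dmulti p.2 (0 : E) p.1) /
    (k ^+ mlen p.2 * M (mlen p.2) * (mlen p.2)`!%:R))%:E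
    | p in [set: 'rV[R]_N * {ffun 'I_N -> nat}]] = [set 0%E].
  apply/seteqP; split=> [_ [[x a] _ <-]|_ ->] /=.
    by rewrite (Dmulti0 a x) normc0 mul0r.
  by exists (0, [ffun=> 0%N]) => //=; rewrite Dmulti0 normc0 mul0r.
by rewrite ereal_sup1.
Qed.

Lemma ultradiff_normZ k (c : R[i]) (F : E) :
  (ultradiff_norm M k (c *: F) <= (normc c)%:E * ultradiff_norm M k F)%E.
Proof.
have sF : smooth F by have /asboolP[] := ultradiff_funP F.
apply: ub_ereal_sup => _ [[x a] _ <-] /=.
rewrite -[X in Dmulti a X]/(fun y => c * (F : ultradiff M N) y).
have -> : Dmulti a (fun y => c * (F : ultradiff M N) y) x = c * Dmulti a F x.
  have s0 : smooth (0 : 'rV[R]_N -> R[i]) by split; exact: smoothR0.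
  have := Dmulti_lin c a x sF s0; rewrite Dmulti0 addr0 => <-.
  by congr (Dmulti _ _ _); apply/funext => y; rewrite addr0.
rewrite normcM -mulrA EFinM lee_wpmul2l ?lee_fin ?normc_nonneg//.
by apply: ereal_sup_ubound; exists (x, a).
Qed.

Lemma lim_base0 W : lim_base W -> W 0.
Proof.
move=> [_ /(_ 0%N)[r r0]]; apply; last by rewrite ultradiff_norm0 lte_fin.
by rewrite /ultradiff_step /= ultradiff_norm0 ltry.
Qed.

Lemma lim_baseI W V : lim_base W -> lim_base V -> lim_base (W `&` V).
Proof.
move=> [cW bW] [cV bV]; split=> [c d F G cd [WF VF] [WG VG]|n].
  by split; [exact: cW|exact: cV].
have [r r0 rW] := bW n; have [t t0 tV] := bV n.
exists (Num.min r t) => [|F sF]; first by rewrite lt_min r0.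
rewrite EFin_min lt_min => /andP[Fr Ft].
by split; [exact: rW|exact: tV].
Qed.

Lemma lim_base_half W : lim_base W ->
  exists2 V, lim_base V & forall F G, V F -> V G -> W (F + G).
Proof.
move=> [cW bW]; exists [set F | W (2 *: F)]; last first.
  move=> F G /= WF WG.
  have := cW 2^-1 2^-1 _ _ _ WF WG; rewrite !scalerA mulVf ?pnatr_eq0// !scale1r.
  apply; rewrite normcV normc2; lra.
split=> [c d F G cd WF WG|n] /=.
  by rewrite scalerDr !scalerA ![2 * _]mulrC -!scalerA; exact: cW.
have [r r0 rW] := bW n; exists (2^-1 * r) => [|F sF Fr]; first by rewrite mulr_gt0.
have nF := ultradiff_normZ (h n) 2 F; rewrite normc2 in nF.
have lt2 : (ultradiff_norm M (h n) (2 *: F) < r%:E)%E.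
  apply: (le_lt_trans nF).
  by rewrite -lte_pdivlMl.
by apply: rW => //; exact: lt_trans lt2 (ltry _).
Qed.

Lemma lim_nbhs_filter F : ProperFilter (nbhs (F : E)).
Proof.
split.
  by move=> [W bW] /(_ 0 (lim_base0 bW)).
split.
- exists setT => //; split=> // n; by exists 1.
- move=> A B [W bW WA] [V bV VB]; exists (W `&` V); first exact: lim_baseI.
  by move=> G [/WA ? /VB ?]; split.
- by move=> A B AB [W bW WA]; exists W => // G /WA /AB.
Qed.

Lemma lim_nbhs_singleton (F : E) (A : set E) : nbhs F A -> A F.
Proof.
by move=> [W bW /(_ 0 (lim_base0 bW))]; rewrite addr0.
Qed.

Lemma lim_nbhs_nbhs (F : E) (A : set E) : nbhs F A -> nbhs F (nbhs^~ A).
Proof.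
move=> [W /lim_base_half[V bV VW] WA]; exists V => // G VG.
by exists V => // G' VG'; rewrite -addrA; apply/WA/VW.
Qed.

HB.instance Definition _ := Nbhs_isNbhsTopological.Build E
  lim_nbhs_filter lim_nbhs_singleton lim_nbhs_nbhs.

End InductiveLimit.

Section Fourier.
Variables (R : realType) (M : weight_sequence R) (N : nat).
Implicit Types (xi : 'rV[int]_N) (x : 'rV[R]_N).

Definition dotz x xi : R := \sum_i x 0 i * (xi 0 i)%:~R.

Definition enorm xi : R := Num.sqrt (\sum_i (xi 0 i)%:~R ^+ 2).

Definition expNi xi : 'rV[R]_N -> R[i] :=
  fun x => cos (dotz x xi) -i* sin (dotz x xi).

Definition phase xi (k c : R) : 'rV[R]_N -> R := fun x => k * cos (dotz x xi + c).

Lemma derive_line (f : 'rV[R]_N -> R) x v (d : R) :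
  is_derive (0 : R) 1 (fun t : R => f (t *: v + x)) d -> is_derive x v f d.
Proof.
have E : (fun t : R => t^-1 *: (((fun t : R => f (t *: v + x)) \o shift 0) (t *: 1)
    - f (0 *: v + x))) = (fun t : R => t^-1 *: ((f \o shift x) (t *: v) - f x)).
  by apply/funext => t /=; rewrite scale0r add0r addr0 [t *: 1]mulr1.
by case; rewrite /derivable /derive E => df <-; split.
Qed.

Lemma dotz_line x i (t : R) xi :
  dotz (t *: delta_mx 0 i + x) xi = t * (xi 0 i)%:~R + dotz x xi.
Proof.
rewrite /dotz (eq_bigr (fun j => t * ((j == i)%:R * (xi 0 j)%:~R) +
    x 0 j * (xi 0 j)%:~R)); last by move=> j _; rewrite !mxE eqxx/= mulrDl mulrA.
rewrite big_split/= -mulr_sumr; congr (_ * _ + _).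
rewrite (bigD1 i)//= eqxx mul1r big1 ?addr0// => j /negPf ->.
by rewrite mul0r.
Qed.

Lemma is_derive_phase xi k c i x : is_derive x (delta_mx 0 i) (phase xi k c)
  (phase xi (k * (xi 0 i)%:~R) (c + pi / 2) x).
Proof.
apply: derive_line.
have -> : (fun t : R => phase xi k c (t *: delta_mx 0 i + x)) =
    k *: (cos \o (fun t : R => (xi 0 i)%:~R * t + (dotz x xi + c))).
  by apply/funext => t; rewrite /phase dotz_line [t * _]mulrC -addrA.
have -> : phase xi (k * (xi 0 i)%:~R) (c + pi / 2) x =
    k *: ((xi 0 i)%:~R * - sin ((xi 0 i)%:~R * 0 + (dotz x xi + c))).
  by rewrite /phase addrA cosDpihalf mulr0 add0r -mulrA.
apply: is_deriveZ; rewrite mulrC; apply: is_derive1_comp.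
rewrite -[X in is_derive _ _ _ X]addr0; apply: is_deriveD.
rewrite -[X in is_derive _ _ _ X]mulr1.
exact: (@is_deriveZ _ _ _ id).
Qed.

Lemma continuous_phase xi k c : continuous (phase xi k c).
Proof.
have cdot : continuous (fun x => dotz x xi).
  rewrite /dotz; apply: (continuous_big (@add_continuous R^o)) => i _ x.
  apply: (@continuousM _ _ (fun x : 'rV[R]_N => x 0 i) (cst _));
    [exact: coord_continuous|exact: cst_continuous].
move=> x; apply: (@continuousM _ _ (cst k) (fun x => cos (dotz x xi + c)));
  first exact: cst_continuous.
apply: (@continuous_comp _ _ _ (fun x => dotz x xi + c) cos);
  last exact: continuous_cos.
apply: (@continuousD _ R^o _ (fun x => dotz x xi) (cst c));
  [exact: cdot|exact: cst_continuous].
Qed.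

Lemma pderivs_phase xi k c s : pderivs s (phase xi k c) =
  phase xi (k * \prod_(i <- s) (xi 0 i)%:~R) (c + (size s)%:R * (pi / 2)).
Proof.
elim: s => [|i s IH]; first by rewrite big_nil mulr1 mul0r addr0.
rewrite /= -/(pderivs s _) IH; apply/funext => x.
rewrite (@derive_val _ _ _ _ _ _ _ (is_derive_phase _ _ _ _ _)) big_cons.
by congr (phase _ _ _ _); rewrite /= -?(natr1 (size s)); ring.
Qed.

Lemma smoothR_phase xi k c : smoothR (phase xi k c).
Proof.
move=> s; rewrite pderivs_phase; split=> [|i x]; first exact: continuous_phase.
by apply: ex_derive; exact: is_derive_phase.
Qed.

Lemma expNi_phase xi :
  (fun x => complex.Re (expNi xi x)) = phase xi 1 0 /\
  (fun x => complex.Im (expNi xi x)) = phase xi 1 (pi / 2).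
Proof.
split; apply/funext => x; rewrite /phase /= mul1r ?addr0//.
by rewrite cosDpihalf.
Qed.

Lemma weight_ge1 n : 1 <= M n.
Proof.
suff: 1 <= M n <= M n.+1 by case/andP.
elim: n => [|n /andP[n1 nS]]; first by rewrite weight0 weight1 lexx.
rewrite (le_trans n1 nS) /= -(ler_pM2l (weight_gt0 M n)).
apply: le_trans (weight_logconvex M n); rewrite expr2 ler_wpM2r//.
exact/ltW/weight_gt0.
Qed.

Lemma normc_le (a b : R) : normc (a +i* b) <= `|a| + `|b|.
Proof.
rewrite -[leRHS]ger0_norm ?addr_ge0// -sqrtr_sqr ler_wsqrtr//.
rewrite sqrrD !real_normK ?num_real// -addrA lerD2l lerDr.
by rewrite mulrn_wge0// mulr_ge0.
Qed.

Lemma size_mword (a : {ffun 'I_N -> nat}) : size (mword a) = mlen a.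
Proof.
rewrite size_flatten /shape -map_comp sumnE big_map big_enum /=.
by apply: eq_bigr => i _; rewrite size_nseq.
Qed.

Lemma le_phase xi k c x : `|phase xi k c x| <= `|k|.
Proof.
by rewrite normrM ler_piMr// ler_norml cos_geN1 cos_le1.
Qed.

Lemma le_prod_xi xi (s : seq 'I_N) :
  `|\prod_(i <- s) (xi 0 i)%:~R| <= (1 + \sum_i `|(xi 0 i)%:~R|) ^+ size s :> R.
Proof.
elim: s => [|i s IH]; first by rewrite big_nil normr1.
rewrite big_cons exprS normrM ler_pM//.
by rewrite (bigD1 i)//= addrCA lerDl addr_ge0// sumr_ge0.
Qed.

Lemma cosD2piz (t : R) (z : int) : cos (t + (pi *+ 2) * z%:~R) = cos t.
Proof.
case: (intP z) => [|n|n]; first by rewrite mulr0 addr0.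
  by rewrite mulr_natr (periodicn (@cosD2pi R)).
by rewrite -[in RHS](subrK ((pi *+ 2) * n.+1%:R) t) [X in _ = cos (_ + X)]mulr_natr
  (periodicn (@cosD2pi R)) mulrNz mulrN.
Qed.

Lemma sinD2piz (t : R) (z : int) : sin (t + (pi *+ 2) * z%:~R) = sin t.
Proof.
have cs u : sin u = - cos (u + pi / 2) :> R by rewrite cosDpihalf opprK.
by rewrite !cs addrAC cosD2piz.
Qed.

Lemma expNi_ultradiff xi : expNi xi \in @ultradiff_pred R M N.
Proof.
apply/asboolP; split.
- by rewrite /smooth; have [-> ->] := expNi_phase xi; split; exact: smoothR_phase.
- move=> x i; rewrite /expNi [x + _]addrC dotz_line addrC.
  by rewrite cosD2piz sinD2piz.
- exists 2, (1 + \sum_i `|(xi 0 i)%:~R|); split => // [|x a].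
    by rewrite ltr_pwDl// sumr_ge0.
  rewrite /Dmulti normcM; have -> : normc ((- 'i%C) ^+ mlen a) = 1 :> R.
    elim: (mlen a) => [|n IH]; first by rewrite expr0 normc1.
    by rewrite exprS normcM IH mulr1 /= oppr0 expr0n add0r sqrrN expr1n sqrtr1.
  have [-> ->] := expNi_phase xi; rewrite mul1r !pderivs_phase.
  apply: (le_trans (normc_le _ _)); apply: (le_trans (lerD (le_phase _ _ _ _)
    (le_phase _ _ _ _))); rewrite mul1r -size_mword -mulr2n -[leLHS]mulr_natl.
  rewrite -!mulrA ler_pM2l// -[leLHS]mulr1 ler_pM//; first exact: le_prod_xi.
  rewrite -[leLHS]mulr1 ler_pM// ?weight_ge1// ler1n; exact: fact_gt0.
Qed.

Definition expNi_lim h xi : ultradiff_lim M N h :=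
  Ultradiff (expNi_ultradiff xi).

Definition fourier h (u : ultradiff_lim M N h -> R[i]) xi : R[i] :=
  ((pi *+ 2) ^- N)%:C * u (expNi_lim h xi).

End Fourier.

(* Main.v *)
From mathcomp Require Import all_boot all_order all_algebra.
From mathcomp Require Import all_classical all_reals all_analysis.
From mathcomp Require Import complex.
Require Import Defs.
Import Order.TTheory GRing.Theory Num.Theory.
Import numFieldNormedType.Exports.
Import Normc.
Local Open Scope classical_set_scope.
Local Open Scope ring_scope.

(** The exponential [e_xi = e^{-i x xi}] is an eigenvector of every [D^a], with
    an eigenvalue of modulus at most [|xi| ^ |a|]. Its norm in the step with
    parameter [k] is therefore at most the supremum over [n] of
    [|xi| ^ n / (k ^ n m_n n!)], which is dominated by the right-hand side of
    the theorem as soon as [1 / k <= eps] ([ultradiff_norm_expNi]).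

    A continuous functional on the inductive limit is bounded on each step
    ([continuous_bounded_step]). Since the parameters [h n] tend to infinity,
    some step has [1 / h n <= eps], and the bound of [u] on that step, applied
    to [e_xi], is the claim. Only this one step enters, so the constant depends
    on [eps] but not on [xi]. *)

Lemma coord_le_enorm (R : realType) (N : nat) (xi : 'rV[int]_N) (i : 'I_N) :
  `|(xi 0 i)%:~R| <= enorm R xi.
Proof.
rewrite -sqrtr_sqr ler_wsqrtr// (bigD1 i)//= lerDl sumr_ge0// => j _.
exact: sqr_ge0.
Qed.

Lemma prod_coord_le_enorm (R : realType) (N : nat) (xi : 'rV[int]_N)
    (s : seq 'I_N) :
  `|\prod_(i <- s) (xi 0 i)%:~R| <= enorm R xi ^+ size s.
Proof.
elim: s => [|i s IH]; first by rewrite big_nil normr1.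
by rewrite big_cons exprS normrM ler_pM// coord_le_enorm.
Qed.

Lemma normc_Dmulti_expNi (R : realType) (N : nat) (xi : 'rV[int]_N)
    (a : {ffun 'I_N -> nat}) (x : 'rV[R]_N) :
  normc (Dmulti a (@expNi R N xi) x) = `|\prod_(i <- mword a) (xi 0 i)%:~R|.
Proof.
rewrite /Dmulti normcM; have -> : normc ((- 'i%C) ^+ mlen a) = 1 :> R.
  elim: (mlen a) => [|n IH]; first by rewrite expr0 normc1.
  by rewrite exprS normcM IH mulr1 /= oppr0 expr0n add0r sqrrN expr1n sqrtr1.
have [-> ->] := @expNi_phase R N xi.
(* The imaginary part is the real part with its phase shifted by pi / 2, so the
   two are [K * cos t] and [- K * sin t] for the same angle [t]. *)
rewrite mul1r !pderivs_phase /phase !mul1r add0r [pi / 2 + _]addrC addrA.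
rewrite cosDpihalf /= !exprMn sqrrN -mulrDr cos2Dsin2 mulr1.
exact: sqrtr_sqr.
Qed.

(** The factor [|xi| ^ n / k ^ n] from [D^a e_xi] is at most
    [eps ^ n * (1 + |xi|) ^ n] exactly because [1 / k <= eps]. *)
Lemma ultradiff_norm_expNi (R : realType) (M : weight_sequence R) (N : nat)
    (k eps : R) (xi : 'rV[int]_N) : 0 < k -> k^-1 <= eps ->
  (ultradiff_norm M k (@expNi R N xi) <=
     ereal_sup [set (eps ^+ n * (1 + enorm R xi) ^+ n / (M n * n`!%:R))%:E
               | n in [set: nat]])%E.
Proof.
move=> k0 keps; apply: ge_ereal_sup => _ [[x a] _ <-] /=.
apply: le_trans; last by apply: ereal_sup_ubound; exists (mlen a).
have e0 : 0 <= enorm R xi by exact: sqrtr_ge0.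
rewrite lee_fin normc_Dmulti_expNi -mulrA invfM mulrA.
apply: ler_pM => //.
- by rewrite mulr_ge0// invr_ge0 exprn_ge0// ltW.
- by rewrite invr_ge0 mulr_ge0// ltW// weight_gt0.
rewrite mulrC -exprVn ler_pM// ?exprn_ge0 ?invr_ge0 ?(ltW k0)//.
  by rewrite lerXn2r// nnegrE ?invr_ge0 ?(ltW k0)// (le_trans _ keps)// invr_ge0 ltW.
rewrite (le_trans (prod_coord_le_enorm _ _ _ _))// size_mword.
by rewrite lerXn2r// ?nnegrE ?addr_ge0// lerDr.
Qed.

(** A basic neighbourhood of 0 on which [|u| < 1] contains a ball of radius
    [r] of the step; scaling a given [F] into that ball bounds [u F]. *)
Lemma continuous_bounded_step (R : realType) (M : weight_sequence R) (N : nat)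
    (h : nat -> R) (u : {linear ultradiff_lim M N h -> R[i]^o}) (n : nat) :
  continuous u ->
  exists2 C : R, 0 < C & forall (F : ultradiff_lim M N h) (s : R), 0 < s ->
    (ultradiff_norm M (h n) F <= s%:E)%E -> normc (u F) <= C * s.
Proof.
move=> cu.
have [W [_ bW] Wu] : lim_nbhs (0 : ultradiff_lim M N h) (u @^-1` ball (u 0) 1).
  by apply: (cu 0); exact: nbhsx_ballx.
have [r r0 rW] := bW n.
exists (2 / r) => [|F s s0 Fs]; first by rewrite divr_gt0.
pose c : R := r / (2 * s).
have c0 : 0 < c by rewrite divr_gt0// mulr_gt0.
have cr : c * (2 * s) = r by rewrite divfK// mulf_neq0// gt_eqF.
have nc : normc c%:C%C = c by rewrite /= expr0n addr0 sqrtr_sqr ger0_norm// ltW.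
have cF : (ultradiff_norm M (h n) (c%:C%C *: F) < r%:E)%E.
  apply: (le_lt_trans (ultradiff_normZ _ _ _)); rewrite nc.
  apply: (@le_lt_trans _ _ (c%:E * s%:E)%E).
    by rewrite lee_wpmul2l// lee_fin ltW.
  by rewrite -EFinM lte_fin -cr ltr_pM2l// ltr_pMl// ltr1n.
have /Wu : W (c%:C%C *: F) by apply: rW => //; exact: lt_trans cF (ltry _).
rewrite /= add0r linearZ linear0 -ball_normE /= sub0r normrN.
rewrite -[_ < 1]/(((normc (c%:C%C * u F))%:C)%C < 1) ltcR normcM nc => /ltW uF.
rewrite -(ler_pM2l c0) (le_trans uF)//.
by rewrite [2 / r * s]mulrAC mulrA cr divff// gt_eqF.
Qed.

Theorem theorem4p6 (R : realType) (M : weight_sequence R) (N : nat)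
    (hN : (1 <= N)%N)
    (h : nat -> R) (h_gt0 : forall n, 0 < h n)
    (h_incr : forall m n, (m < n)%N -> h m < h n)
    (h_cvg : h @ \oo --> +oo)
    (u : {linear ultradiff_lim M N h -> R[i]^o}) (cu : continuous u)
    (eps : R) (eps_gt0 : 0 < eps) :
  exists2 C : R, 0 < C & forall xi : 'rV[int]_N,
    ((normc (fourier u xi))%:E <= C%:E *
       ereal_sup [set (eps ^+ n * (1 + enorm R xi) ^+ n / (M n * n`!%:R))%:E
                 | n in [set: nat]])%E.
Proof.
have [n hn] : exists n, eps^-1 <= h n.
  have /cvgryPge/(_ eps^-1)[n _ nh] := h_cvg.
  by exists n; apply: nh => /=.
have hneps : (h n)^-1 <= eps by rewrite -[leRHS]invrK lef_pV2// posrE// invr_gt0.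
have [C C0 uC] := continuous_bounded_step _ _ _ _ u n cu.
have pN : 0 < (pi *+ 2) ^- N :> R by rewrite invr_gt0 exprn_gt0// mulrn_wgt0// pi_gt0.
exists ((pi *+ 2) ^- N * C) => [|xi]; first exact: mulr_gt0.
have := ultradiff_norm_expNi _ M _ _ _ xi (h_gt0 n) hneps.
set S := ereal_sup _ => uS.
have S1 : (1%:E <= S)%E.
  apply: ereal_sup_ubound; exists 0%N => //.
  by rewrite !expr0 weight0 fact0 !mulr1 divr1.
case: S S1 uS => [s| |//] s1 uS; last by rewrite gt0_muley ?leey// lte_fin mulr_gt0.
rewrite lee_fin in s1.
rewrite -EFinM lee_fin normcM /= expr0n addr0 sqrtr_sqr ger0_norm ?(ltW pN)//.
rewrite -mulrA ler_wpM2l ?(ltW pN)// uC//.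
exact: lt_le_trans s1.
Qed.
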